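(* For the infinite server G/G/$\infty$ queue with a given inter-generation time distribution $F_X$ of mean $1/\lambda$ and a service time distribution $F_S$ of mean $1/\mu$, with $\lambda<\mu$, $$A^{\mathrm{ave}}_{\mathrm{G/G/}\infty}(\lambda,\mu)\ \le\ A^{\mathrm{ave}}_{\mathrm{G/D/}\infty}(\lambda,\mu)$$ for all packet generation and service rates $\lambda$ and $\mu$, where $A^{\mathrm{ave}}_{\mathrm{G/D/}\infty}(\lambda,\mu)$ is the average age of the queue with the same $F_X$ and with deterministic service $S=1/\mu$ almost surely.
   Context: Update packets $i=1,2,\dots$ are generated at times $t_1<t_2<\cdots$ of a renewal process with i.i.d. inter-generation times distributed as $X\sim F_X$. In the G/G/$\infty$ queue each generated packet is immediately put into service at its own new server; service times $S_i$ are i.i.d. with distribution $F_S$, independent of the generation process, so packet $i$ reaches the destination at time $t_i'=t_i+S_i$. With $\mathcal{P}(t)$ the set of packets received up to time $t$, the age is $A(t)=\min_{i\in\mathcal{P}(t)}(t-t_i)$ and the average age is $A^{\mathrm{ave}}=\limsup_{T\to\infty}\mathbb{E}\left[\frac1T\int_0^TA(t)\,dt\right]$. $A^{\mathrm{ave}}_{\mathrm{G/G/}\infty}(\lambda,\mu)$ denotes the average age of this queue. *)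

(* Defs.v *)
From mathcomp Require Export all_boot all_order all_algebra.
From mathcomp Require Export finmap.
From mathcomp Require Export all_classical all_reals all_analysis.
Export Order.TTheory GRing.Theory Num.Theory.
Export numFieldNormedType.Exports.

Set Implicit Arguments.
Unset Strict Implicit.
Unset Printing Implicit Defensive.

#[global] Open Scope classical_set_scope.
#[global] Open Scope ring_scope.

Definition mutually_independent d (T : measurableType d) (R : realType)
    (P : probability T R) (I : choiceType) (Y : I -> {RV P >-> R}) : Prop :=
  forall (J : {fset I}) (B : I -> set R), (forall i, measurable (B i)) ->
    P (\bigcap_(i in [set` J]) (Y i @^-1` B i)) =
    (\prod_(i <- J) P (Y i @^-1` B i))%E.

(* The law is compared with F on measurable sets only, since a measure has no
   meaningful value elsewhere. *)
Definition has_law d (T : measurableType d) (R : realType)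
    (P : probability T R) (Y : {RV P >-> R}) (F : probability R R) : Prop :=
  forall B : set R, measurable B -> distribution P Y B = F B.

Definition gen_service d (T : measurableType d) (R : realType)
    (P : probability T R) (X S : nat -> {RV P >-> R}) (k : nat + nat)
    : {RV P >-> R} :=
  match k with inl i => X i | inr i => S i end.

(* Packets are numbered from 0: X i and S i are the inter-generation time
   preceding packet i and its service time.  Joint independence of the two
   sequences expresses at once that each is independent and that the services
   are independent of the generation process. *)
Record GGinf_queue d (T : measurableType d) (R : realType)
    (P : probability T R) (FX FS : probability R R)
    (X S : nat -> {RV P >-> R}) : Prop := {
  GGinf_X_law : forall i, has_law (X i) FX ;
  GGinf_S_law : forall i, has_law (S i) FS ;
  GGinf_indep : mutually_independent (gen_service X S)
}.

Definition GDinf_queue d (T : measurableType d) (R : realType)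
    (P : probability T R) (FX : probability R R) (s : R)
    (X S : nat -> {RV P >-> R}) : Prop :=
  GGinf_queue FX (\d_s : probability R R) X S.

Section age.
Context d (T : measurableType d) (R : realType) (P : probability T R).
Variables X S : nat -> {RV P >-> R}.

Definition gen_time (i : nat) (w : T) : R := \sum_(k < i.+1) X k w.

Definition rec_time (i : nat) (w : T) : R := gen_time i w + S i w.

Definition received (t : R) (w : T) : set nat := [set i | rec_time i w <= t].

(* The singleton [set t] is the initial condition: the destination holds at
   time 0 an update generated at time 0, so the age is t until the first
   reception.  When X > 0 and S >= 0 almost surely, with i.i.d. X, almost surely
   only finitely many packets have been received by time t, so that the infimum
   is a minimum lying in [0, t]. *)
Definition age (t : R) (w : T) : R :=
  inf ([set t] `|` [set t - gen_time i w | i in received t w]).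

Definition average_age : \bar R :=
  limf_esup (fun H : R =>
    ('E_P[fun w => (H^-1 * \int[lebesgue_measure]_(t in `[0, H]) age t w)%R])%E)
    +oo.

End age.

(* Main.v *)
Require Import Defs.
From mathcomp Require Import measurable_realfun.

Set Implicit Arguments.
Unset Strict Implicit.
Unset Printing Implicit Defensive.

(* Write g_i for the generation times and r_i = g_i + S_i.  Since g_j is the sum
   of the X_i with i <= j, the sum of the X_i over the packets received by time t
   is at most t - A(t), with equality when the service time is constant, for then
   packets arrive in order.  Integrating over t in [0, H],
     \int_0^H A(t) dt <= H^2/2 - \sum_i X_i (H - r_i)^+,
   again with equality for constant service.  As S_i is independent of
   (g_i, X_i), Jensen's inequality for (.)^+ shows that each mean gain
   E[X_i (H - r_i)^+] decreases when S_i is replaced by its mean.  Hence the mean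
   ages over [0, H] compare for every H > 0, and so do their limits superior. *)

(** * Comparison of integrals off a null set *)

(* Integrals of non-measurable functions are lower integrals, and these are
   still monotone; this spares proving that the age is measurable. *)
Section off_null_set.
Local Open Scope ereal_scope.
Context d (T : measurableType d) (R : realType).
Variables (mu : {measure set T -> \bar R}) (N : set T).
Hypotheses (mN : measurable N) (muN0 : mu N = 0).
Import HBNNSimple.

(** The integral of [f] is a supremum over simple functions below [f]. Multiplying one by the
    indicator of the complement of [N] keeps its integral and puts it below [g] everywhere. *)
Lemma ge0_le_integral_off_null (f g : T -> \bar R) :
  (forall x, 0 <= f x) -> (forall x, 0 <= g x) ->
  (forall x, ~ N x -> f x <= g x) ->
  \int[mu]_x f x <= \int[mu]_x g x.
Proof.
move=> f0 g0 fg; rewrite !ge0_integralTE//.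
apply: ge_ereal_sup => _ [h /= hf <-].
have mNC : measurable (~` N) by exact: measurableC.
pose h' := mul_nnsfun h (indic_nnsfun R mNC).
have -> : sintegral mu h = sintegral mu h'.
  have sE (k : {nnsfun T >-> R}) : sintegral mu k = \int[mu]_x (k x)%:E.
    by rewrite integral_nnsfun// patch_setT.
  rewrite !sE; apply: ge0_ae_eq_integral => //.
  - exact/measurable_EFinP.
  - exact/measurable_EFinP.
  - by move=> x _; rewrite lee_fin.
  - by move=> x _; rewrite lee_fin.
  exists N; split=> // x; apply: contra_notP => Nx _ /=.
  by rewrite /= mindicE mem_set// mulr1.
apply: ereal_sup_ubound; exists h' => // x /=.
rewrite mindicE; have [Nx|_] := boolP (x \in ~` N).
  by rewrite mulr1; apply: le_trans (hf x) (fg _ _); exact: set_mem Nx.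
by rewrite mulr0.
Qed.

(** Negative parts vanish off [N], so they integrate to 0 by the previous lemma and only positive
    parts remain to be compared. *)
Lemma le_integral_off_null (f g : T -> \bar R) :
  (forall x, ~ N x -> 0 <= f x) -> (forall x, ~ N x -> f x <= g x) ->
  \int[mu]_x f x <= \int[mu]_x g x.
Proof.
move=> f0 fg.
have neg0 (h : T -> \bar R) : (forall x, ~ N x -> 0 <= h x) ->
    \int[mu]_x h x = \int[mu]_x h^\+ x.
  move=> h0; rewrite integralE [X in _ - X](_ : _ = 0) ?sube0//.
  apply/eqP; rewrite eq_le integral_ge0// andbT.
  rewrite -[leRHS](integral0 mu setT).
  apply: ge0_le_integral_off_null => // x Nx.
  by rewrite funenegE ge_max lexx leeNl oppe0 h0.
rewrite neg0// [leRHS]neg0; last first.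
  by move=> x Nx; apply: le_trans (fg _ Nx); exact: f0.
apply: ge0_le_integral_off_null => // x Nx.
by rewrite !funeposE ge_max !le_max lexx fg// orbT.
Qed.

End off_null_set.

Lemma integrable_id_itv (R : realType) (H : R) :
  lebesgue_measure.-integrable `[0, H] (fun t : R => t%:E).
Proof.
apply: (@continuous_compact_integrable _ (fun t => t)).
  exact: segment_compact.
by apply: continuous_subspaceT => t; exact: cvg_id.
Qed.

(** * The age along a fixed sample path *)

Section path.
Context (R : realType).
Variables x s : nat -> R.
Hypothesis x_gt0 : forall i, 0 < x i.
Hypothesis s_ge0 : forall i, 0 <= s i.

(** Together with [path_age], this mirrors [gen_time] and [age] at a fixed outcome, so that
    [mean_on_path] holds by conversion. *)
Definition path_gen (i : nat) : R := \sum_(k < i.+1) x k.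

Definition path_age (t : R) : R :=
  inf ([set t] `|`
    [set t - path_gen i | i in [set i | path_gen i + s i <= t]]).

(** Extended-real valued, so that the series makes sense before [path_info_le] shows it finite.
    Unlike the age, it can be integrated term by term. *)
Definition path_info (t : R) : \bar R :=
  (\sum_(i <oo) (x i * \1_(`[path_gen i + s i, +oo[) t)%:E)%E.

Lemma path_term_ge0 i t : 0 <= x i * \1_(`[path_gen i + s i, +oo[) t.
Proof. by rewrite mulr_ge0// ltW. Qed.

Lemma path_info_ge0 t : (0 <= path_info t)%E.
Proof. by apply: nneseries_ge0 => i _ _; rewrite lee_fin path_term_ge0. Qed.

Lemma path_gen_ge0 i : 0 <= path_gen i.
Proof. by apply: sumr_ge0 => k _; exact: ltW. Qed.

Lemma path_gen_mono i j : (i <= j)%N -> path_gen i <= path_gen j.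
Proof.
move=> ij; rewrite /path_gen -!(big_mkord xpredT x).
rewrite [leRHS](big_cat_nat _ (n := i.+1))//= lerDl.
by apply: sumr_ge0 => k _; exact: ltW.
Qed.

Lemma path_age_lb t : 0 <= t ->
  lbound ([set t] `|`
    [set t - path_gen i | i in [set i | path_gen i + s i <= t]]) 0.
Proof.
move=> t0 _ [->//|[i /= it <-]]; rewrite subr_ge0.
by apply: le_trans it; rewrite lerDl.
Qed.

Lemma path_age_has_inf t : 0 <= t ->
  has_inf ([set t] `|`
    [set t - path_gen i | i in [set i | path_gen i + s i <= t]]).
Proof.
move=> t0; split; first by exists t; left.
by exists 0; exact: path_age_lb.
Qed.

Lemma path_age_ge0 t : 0 <= t -> 0 <= path_age t.
Proof.
by move=> t0; apply: lb_le_inf; [exists t; left | exact: path_age_lb].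
Qed.

Lemma path_age_le t : 0 <= t -> path_age t <= t.
Proof.
move=> t0; apply: ge_inf; last by left.
by have [] := path_age_has_inf t0.
Qed.

Lemma path_age_le_sub t i : 0 <= t -> path_gen i + s i <= t ->
  path_age t <= t - path_gen i.
Proof.
move=> t0 it; apply: ge_inf; last by right; exists i.
by have [] := path_age_has_inf t0.
Qed.

Lemma indic_ge (a t : R) : \1_(`[a, +oo[) t = (a <= t)%R%:R :> R.
Proof. by rewrite indicE mem_setE in_itv/= andbT. Qed.

(** Induction on partial sums. If packet n has been received, the age is at most t - g_n, while the
    sum up to n is at most g_n; otherwise packet n adds nothing. *)
Lemma path_info_le t : 0 <= t -> (path_info t <= (t - path_age t)%:E)%E.
Proof.
move=> t0; apply: lime_le.
  by apply: is_cvg_nneseries => i _ _; rewrite lee_fin path_term_ge0.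
apply: nearW => n; rewrite sumEFin lee_fin.
elim: n => [|n IHn].
  by rewrite big_geq// subr_ge0; exact: path_age_le.
rewrite big_nat_recr//= indic_ge; have [nt|_] := leP (path_gen n + s n) t; last first.
  by rewrite mulr0 addr0.
rewrite mulr1 lerBrDr -lerBrDl; apply: le_trans (path_age_le_sub t0 nt) _.
rewrite lerB// /path_gen big_ord_recr/= lerD2r big_mkord.
apply: ler_sum => k _; by rewrite ler_piMr// ltW.
Qed.

(* With a constant service time packets arrive in order, so that everything
   generated before a received packet has been received. *)
Lemma path_info_cst t c : 0 <= t -> (forall i, s i = c) ->
  path_info t = (t - path_age t)%:E.
Proof.
move=> t0 sc; apply/eqP; rewrite eq_le path_info_le//=.
have fin : path_info t \is a fin_num.
  by rewrite ge0_fin_numE ?path_info_ge0// (le_lt_trans (path_info_le t0))// ltry.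
rewrite -(fineK fin) lee_fin lerBlDr -lerBlDl.
apply: lb_le_inf; first by exists t; left.
move=> _ [->|[i /= it <-]].
  by rewrite gerBl fine_ge0// path_info_ge0.
rewrite lerB// -lee_fin fineK//.
(* Packets 0 to i have all been received, so the first [i.+1] terms already sum to g_i. *)
apply: le_trans (@nneseries_lim_ge _ _ _ _ i.+1 _); last first.
  by move=> n _ _; rewrite lee_fin path_term_ge0.
rewrite sumEFin lee_fin /path_gen big_mkord; apply: ler_sum => k _.
rewrite indic_ge (_ : path_gen k + s k <= t) ?mulr1//.
by apply: le_trans it; rewrite !sc lerD2r path_gen_mono// -ltnS.
Qed.

Lemma measurable_path_info : measurable_fun [set: R] path_info.
Proof.
apply: ge0_emeasurable_sum => [i t _ _|i _].
  by rewrite lee_fin path_term_ge0.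
apply/measurable_EFinP; apply: measurable_funM => //.
Qed.

(** Term by term, the indicator of [r_i, +oo[ integrates over [0, H] to (H - r_i)^+. *)
Lemma integral_path_info H :
  (\int[lebesgue_measure]_(t in `[0%R, H]) path_info t =
   \sum_(i <oo) (x i * Num.max (H - (path_gen i + s i)) 0)%:E)%E.
Proof.
rewrite integral_nneseries//; last 2 first.
- by move=> i; apply/measurable_EFinP/measurable_funTS/measurable_funM.
- by move=> i t _; rewrite lee_fin path_term_ge0.
apply: eq_eseriesr => i _.
under eq_integral do rewrite EFinM.
rewrite ge0_integralZl//; last 2 first.
- exact/measurable_EFinP.
- by rewrite lee_fin ltW.
rewrite integral_indic// EFinM; congr (_ * _)%E.
set r := path_gen i + s i.
have r0 : 0 <= r by rewrite addr_ge0// path_gen_ge0.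
(* As r is nonnegative, the left end 0 cuts nothing off. *)
have -> : `[r, +oo[ `&` `[0, H] = `[r, H]%classic.
  apply/seteqP; split => t /=; rewrite !in_itv/= andbT.
    by move=> [-> /andP[_ ->]].
  by move=> /andP[rt ->]; rewrite rt (le_trans r0 rt).
rewrite /= lebesgue_measure_itv/= lte_fin.
have [rH|Hr] := ltP r H.
  by rewrite -EFinB max_l// subr_ge0 ltW.
by rewrite max_r// subr_le0.
Qed.


Lemma integrable_path_info (H : R) :
  lebesgue_measure.-integrable `[0, H] path_info.
Proof.
apply: le_integrable (integrable_id_itv H) => //.
  exact: measurable_funTS measurable_path_info.
move=> t /=; rewrite in_itv/= => /andP[t0 _].
rewrite gee0_abs ?path_info_ge0// ger0_norm//.
by apply: le_trans (path_info_le t0) _; rewrite lee_fin gerBl path_age_ge0.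
Qed.

Lemma integral_path_residual (H : R) :
  (\int[lebesgue_measure]_(t in `[0%R, H]) (t%:E - path_info t) =
   \int[lebesgue_measure]_(t in `[0%R, H]) t%:E -
   \sum_(i <oo) (x i * Num.max (H - (path_gen i + s i)) 0)%:E)%E.
Proof.
rewrite -integral_path_info -integralB//.
- exact: integrable_id_itv.
- exact: integrable_path_info.
Qed.

Lemma integral_path_age_ge0 (H : R) :
  (0 <= \int[lebesgue_measure]_(t in `[0%R, H]) (path_age t)%:E)%E.
Proof.
apply: integral_ge0 => t /=; rewrite in_itv/= => /andP[t0 _].
by rewrite lee_fin path_age_ge0.
Qed.

Lemma integral_path_age_le (H : R) :
  (\int[lebesgue_measure]_(t in `[0%R, H]) (path_age t)%:E <=
   \int[lebesgue_measure]_(t in `[0%R, H]) t%:E -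
   \sum_(i <oo) (x i * Num.max (H - (path_gen i + s i)) 0)%:E)%E.
Proof.
(* Extending by 0 outside [0, H] lets the comparison lemma apply with an empty exceptional set,
   without measurability of the age. *)
rewrite -integral_path_residual integral_mkcond [leRHS]integral_mkcond.
apply: (le_integral_off_null measurable0 (measure0 _)) => t _;
  rewrite !patchE; case: ifPn => // /set_mem/=; rewrite in_itv/= => /andP[t0 _].
  by rewrite lee_fin path_age_ge0.
rewrite leeBrDr ?ge0_fin_numE ?path_info_ge0//; last first.
  by rewrite (le_lt_trans (path_info_le t0))// ltry.
rewrite addeC; apply: le_trans (leeD2r _ (path_info_le t0)) _.
by rewrite -EFinD lee_fin subrK.
Qed.

Lemma integral_path_age_cst (H c : R) : (forall i, s i = c) ->
  (\int[lebesgue_measure]_(t in `[0%R, H]) (path_age t)%:E =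
   \int[lebesgue_measure]_(t in `[0%R, H]) t%:E -
   \sum_(i <oo) (x i * Num.max (H - (path_gen i + s i)) 0)%:E)%E.
Proof.
move=> sc; rewrite -integral_path_residual; apply: eq_integral => t.
move=> /set_mem/=; rewrite in_itv/= => /andP[t0 _].
by rewrite (path_info_cst t0 sc) -EFinB opprB addrC subrK.
Qed.

End path.

(** * Joint laws determined by rectangles *)

Section joint_law.
Local Open Scope ereal_scope.
Context d d1 d2 (T : measurableType d) (T1 : measurableType d1)
  (T2 : measurableType d2) (R : realType).

(** Rectangles are stable under intersection and generate the product sigma-algebra; as [m] is
    finite, the constant sequence [setT] serves as exhaustion. *)
Lemma measure_eq_rectangles (m m' : {measure set (T1 * T2) -> \bar R}) :
  m setT < +oo ->
  (forall A B, measurable A -> measurable B -> m (A `*` B) = m' (A `*` B)) ->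
  forall E, measurable E -> m E = m' E.
Proof.
move=> moo mm' E mE.
pose C : set (set (T1 * T2)) :=
  [set A `*` B | A in measurable & B in measurable].
apply: (measure_unique C (fun=> setT)) => //.
- by rewrite measurable_prod_measurableType.
- move=> _ _ [A1 mA1 [B1 mB1 <-]] [A2 mA2 [B2 mB2 <-]].
  rewrite -setXI; exists (A1 `&` A2); first exact: measurableI.
  by exists (B1 `&` B2) => //; exact: measurableI.
- by move=> _; exists setT => //; exists setT => //; rewrite setXTT.
- by rewrite bigcup_const.
- by move=> _ [A mA [B mB <-]]; exact: mm'.
Qed.

Variable P : probability T R.
Variables (U : T -> T1) (V : T -> T2).
Hypotheses (mU : measurable_fun setT U) (mV : measurable_fun setT V).

Let Z w := (U w, V w).
Let mZ : measurable_fun setT Z := measurable_fun_pair mU mV.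

Lemma pair_law_unique (m : {measure set (T1 * T2) -> \bar R}) :
  (forall A B, measurable A -> measurable B ->
    P (U @^-1` A `&` V @^-1` B) = m (A `*` B)) ->
  forall E, measurable E -> P (Z @^-1` E) = m E.
Proof.
move=> UVm E mE.
pose m1 : {measure set (T1 * T2) -> \bar R} :=
  measure_function_pushforward__canonical__measure_function_Measure P mZ.
apply: (@measure_eq_rectangles m1 m) => //.
by rewrite /m1/= /pushforward preimage_setT probability_setT ltry.
Qed.

(** Both sides are finite measures in E that agree on rectangles: the law of the pair under P
    restricted to C, and its law under P scaled by P C. *)
Lemma pair_indep_event (C : set T) : measurable C ->
  (forall A B, measurable A -> measurable B ->
    P (U @^-1` A `&` V @^-1` B `&` C) = P (U @^-1` A `&` V @^-1` B) * P C) ->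
  forall E, measurable E -> P (Z @^-1` E `&` C) = P (Z @^-1` E) * P C.
Proof.
move=> mC UVC E mE.
pose m1 : {measure set (T1 * T2) -> \bar R} :=
  measure_function_pushforward__canonical__measure_function_Measure
    (mrestr P mC) mZ.
pose m2 : {measure set (T1 * T2) -> \bar R} :=
  measure_function_pushforward__canonical__measure_function_Measure P mZ.
have c0 : (0 <= fine (P C))%R by rewrite fine_ge0.
have cE : P C = (fine (P C))%:E by rewrite fineK// fin_num_measure.
rewrite muleC cE; apply: (@measure_eq_rectangles m1 (mscale (NngNum c0) m2)) => //.
  rewrite /m1/= /pushforward preimage_setT /mrestr setTI.
  by rewrite (le_lt_trans (probability_le1 P mC))// ltry.
by move=> A B mA mB; rewrite /m1 /m2/= /mscale/= -cE muleC -UVC.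
Qed.

End joint_law.

(** * Independence of generation times, later intervals and services *)

Section generation_law.
Local Open Scope ereal_scope.
Context d (T : measurableType d) (R : realType) (P : probability T R).
Variables (FX FS : probability R R) (X S : nat -> {RV P >-> R}).
Hypothesis queue : GGinf_queue FX FS X S.

(* The generation time of packet n - 1, and 0 for n = 0. *)
Definition last_gen (n : nat) (w : T) : R := (\sum_(k < n) X k w)%R.

Lemma measurable_last_gen n : measurable_fun setT (last_gen n).
Proof. by apply: measurable_sum => k. Qed.

Let cylinder (J : {fset nat + nat}) (B : nat + nat -> set R) :=
  \bigcap_(i in [set` J]) (gen_service X S i @^-1` B i).

Let measurable_cylinder J B : (forall i, measurable (B i)) ->
  measurable (cylinder J B).
Proof.
move=> mB; apply: fin_bigcap_measurable => // i _.
by rewrite -[X in measurable X]setTI; exact: measurable_funP.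
Qed.

(* The independence of [last_gen n] and [X n] needs [last_gen n] to be independent
   of every later variable at once for the induction to go through. *)
Let pred_indep_future n := forall (J : {fset nat + nat}) B,
  (forall i, measurable (B i)) -> (forall k, (k < n)%N -> inl k \notin J) ->
  forall A, measurable A ->
  P (last_gen n @^-1` A `&` cylinder J B) =
  P (last_gen n @^-1` A) * P (cylinder J B).

(** Overwriting B at k is harmless because k is outside J. *)
Let cylinderU J B k (A : set R) : k \notin J ->
  cylinder (k |` J)%fset (fun i => if i == k then A else B i) =
  gen_service X S k @^-1` A `&` cylinder J B.
Proof.
move=> kJ; apply/seteqP; split => w /=.
  move=> wJ; split.
    by have := wJ k; rewrite /= !inE eqxx; exact.
  move=> i /= iJ; have := wJ i; rewrite /= !inE iJ orbT.
  by have [ik|_] := eqVneq i k; [rewrite -ik iJ in kJ | exact].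
move=> [wA wJ] i /=; rewrite !inE; have [->//|_] := eqVneq i k.
by move=> /= iJ; exact: wJ.
Qed.

Let indepU J B k (A : set R) : (forall i, measurable (B i)) -> measurable A ->
  k \notin J ->
  P (gen_service X S k @^-1` A `&` cylinder J B) =
  P (gen_service X S k @^-1` A) * P (cylinder J B).
Proof.
move=> mB mA kJ; rewrite -cylinderU// /cylinder.
have [_ _ ind] := queue.
rewrite !ind//; last by move=> i; case: ifP.
rewrite (big_fsetD1 k)/= ?fset1U1// eqxx fsetU1K//; congr (_ * _).
rewrite big_seq [RHS]big_seq; apply: eq_bigr => i iJ.
by case: ifP => // /eqP ik; rewrite -ik iJ in kJ.
Qed.

(** On a rectangle, the event on [X n] is absorbed into the cylinder, since n is still a future
    index for [last_gen n]. The induction hypothesis and [indepU] then factor everything, and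
    [pair_indep_event] passes to general E. *)
Let indep_pair n : pred_indep_future n ->
  forall (J : {fset nat + nat}) B,
  (forall i, measurable (B i)) -> (forall k, (k < n.+1)%N -> inl k \notin J) ->
  forall E, measurable E ->
  P ((fun w => (last_gen n w, X n w)) @^-1` E `&` cylinder J B) =
  P ((fun w => (last_gen n w, X n w)) @^-1` E) * P (cylinder J B).
Proof.
move=> IH J B mB JX E mE.
apply: (pair_indep_event (measurable_last_gen n)) => //.
  exact: measurable_cylinder.
move=> A A' mA mA'.
have nJ : inl n \notin J by exact: JX.
have cyl1 : X n @^-1` A' = cylinder [fset inl n]%fset (fun=> A').
  apply/seteqP; split => w /=.
    by move=> wA i /=; rewrite inE => /eqP ->.
  by move=> /(_ (inl n)) /=; rewrite inE eqxx; exact.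
rewrite -setIA -(cylinderU _ _ nJ) IH//; last 2 first.
- by move=> i; case: ifP.
- move=> k kn; rewrite !inE; apply/norP; split; last exact/JX/ltnW.
  by apply/eqP => -[kE]; rewrite kE ltnn in kn.
rewrite cylinderU// indepU// cyl1 IH//; first by rewrite muleA.
by move=> k kn; rewrite inE; apply/eqP => -[kE]; rewrite kE ltnn in kn.
Qed.

(** [last_gen 0] is constant, so its events are trivial; [last_gen n.+1] is a function of the pair
    treated in [indep_pair]. *)
Lemma indep_future n : pred_indep_future n.
Proof.
elim: n => [|n IHn] J B mB JX A mA.
  have -> : last_gen 0 = cst 0%R by apply/funext => w; rewrite /last_gen big_ord0.
  rewrite preimage_cst; case: ifP => _.
    by rewrite setTI probability_setT mul1e.
  by rewrite set0I measure0 mul0e.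
have addE : last_gen n.+1 @^-1` A =
    (fun w => (last_gen n w, X n w)) @^-1` ((fun z : R * R => z.1 + z.2)%R @^-1` A).
  by apply/seteqP; split => w /=; rewrite /last_gen big_ord_recr.
rewrite addE; apply: (indep_pair IHn) => //.
rewrite -[X in measurable X]setTI.
by apply: (measurable_funD measurable_fst measurable_snd).
Qed.

Lemma last_gen_law n A B : measurable A -> measurable B ->
  P (last_gen n @^-1` A `&` X n @^-1` B) = P (last_gen n @^-1` A) * FX B.
Proof.
move=> mA mB.
have cyl1 : X n @^-1` B = cylinder [fset inl n]%fset (fun=> B).
  apply/seteqP; split => w /=.
    by move=> wA i /=; rewrite inE => /eqP ->.
  by move=> /(_ (inl n)) /=; rewrite inE eqxx; exact.
have [lawX _ _] := queue.
rewrite -(lawX n _ mB) /distribution/= /pushforward cyl1 indep_future//.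
by move=> k kn; rewrite inE; apply/eqP => -[kE]; rewrite kE ltnn in kn.
Qed.

(** Only indices [inl k] are barred from J in [indep_pair], so the one-point cylinder at [inr n]
    qualifies. *)
Lemma service_law n E B : measurable E -> measurable B ->
  P ((fun w => (last_gen n w, X n w)) @^-1` E `&` S n @^-1` B) =
  P ((fun w => (last_gen n w, X n w)) @^-1` E) * FS B.
Proof.
move=> mE mB.
have cyl1 : S n @^-1` B = cylinder [fset inr n]%fset (fun=> B).
  apply/seteqP; split => w /=.
    by move=> wA i /=; rewrite inE => /eqP ->.
  by move=> /(_ (inr n)) /=; rewrite inE eqxx; exact.
have [_ lawS _] := queue.
rewrite -(lawS n _ mB) /distribution/= /pushforward cyl1 indep_pair//.
  exact: indep_future.
by move=> k _; rewrite inE.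
Qed.

End generation_law.

(** * Integrating out an independent variable *)

Section independent_integral.
Local Open Scope ereal_scope.
Context d d1 d2 (T : measurableType d) (T1 : measurableType d1)
  (T2 : measurableType d2) (R : realType) (P : probability T R)
  (F : probability T2 R).

(** The law of (U, V) is the product of the law of U with F, so Tonelli applies after transport to
    the product space. *)
Lemma integral_indep_pair (U : T -> T1) (V : T -> T2) (f : T1 * T2 -> \bar R) :
  measurable_fun setT U -> measurable_fun setT V ->
  (forall A B, measurable A -> measurable B ->
    P (U @^-1` A `&` V @^-1` B) = P (U @^-1` A) * F B) ->
  measurable_fun setT f -> (forall z, 0 <= f z) ->
  \int[P]_w f (U w, V w) = \int[P]_w \int[F]_v f (U w, v).
Proof.
move=> mU mV UV mf f0.
have mZ := measurable_fun_pair mU mV.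
pose Um : {mfun T >-> T1} := mfun_Sub (mem_set mU).
pose Zm : {mfun T >-> (T1 * T2)%type} := mfun_Sub (mem_set mZ).
rewrite -[LHS](@ge0_integral_distribution _ _ _ _ _ P Zm)//.
rewrite (eq_measure_integral (distribution P Um \x F)); last first.
  move=> E mE _; rewrite /distribution/= /pushforward.
  apply: (pair_law_unique mU mV) => // A B mA mB.
  by rewrite UV// [RHS]product_measure1E.
rewrite fubini_tonelli1// ge0_integral_distribution//.
- exact: measurable_fun_fubini_tonelli_F.
- by move=> y; apply: integral_ge0.
Qed.

End independent_integral.

(** * Jensen's inequality for the positive part *)

Section positive_part.
Local Open Scope ereal_scope.
Context (R : realType) (F : probability R R) (m : R).
Hypotheses (F_ge0 : F [set s | (s < 0)%R] = 0)
  (F_mean : 'E_F[fun s : R => s] = m%:E).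

(** c - m is the mean of c - s, and dropping the negative part of c - s only increases the mean. *)
Lemma mean_positive_part (c : R) :
  (Num.max (c - m) 0)%:E <= \int[F]_s (Num.max (c - s) 0)%:E.
Proof.
have mneg : measurable [set s : R | (s < 0)%R].
  by rewrite -set_itvNyo; exact: measurable_itv.
(* Almost surely s = |s|, so the finite mean is also the absolute moment. *)
have int_id : F.-integrable setT (fun s : R => s%:E).
  apply/integrableP; split; first exact/measurable_EFinP.
  apply: (@le_lt_trans _ _ m%:E); last exact: ltry.
  rewrite -F_mean unlock; apply: (le_integral_off_null mneg F_ge0) => // s /negP.
  by rewrite -leNgt => s0; rewrite gee0_abs ?lee_fin.
rewrite EFin_max ge_max integral_ge0 ?andbT; last first.
  by move=> s _; rewrite lee_fin le_max lexx orbT.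
have -> : (c - m)%:E = \int[F]_s (c%:E - s%:E).
  rewrite integralB//; last exact: finite_measure_integrable_cst.
  rewrite integral_cst// EFinB; congr (_ - _).
    by rewrite -[LHS]mule1 -(@probability_setT _ _ _ F).
  by rewrite -F_mean unlock.
rewrite integralE; apply: (@le_trans _ _ (\int[F]_s (fun s => c%:E - s%:E)^\+ s)).
  by rewrite -[leRHS]sube0 leeB// integral_ge0.
rewrite le_eqVlt; apply/orP; left; apply/eqP; apply: eq_integral => s _.
by rewrite funeposE -EFinB EFin_max.
Qed.

End positive_part.

(** * The gain brought by one packet *)

Section gain.
Local Open Scope ereal_scope.
Context (R : realType).

(* [gain H (g, x) s] is the area by which a packet generated at time g + x, at a
   distance x from the previous one, reduces the integral of the age over [0, H].
   The positive part of x keeps it nonnegative on the null set where x < 0. *)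
Definition gain (H : R) (z : R * R) (s : R) : \bar R :=
  (Num.max z.2 0 * Num.max (H - (z.1 + z.2 + s)) 0)%:E.

Lemma gain_ge0 H z s : 0 <= gain H z s.
Proof. by rewrite lee_fin mulr_ge0// le_max lexx orbT. Qed.

Lemma measurable_gain H :
  measurable_fun setT (fun y : (R * R) * R => gain H y.1 y.2).
Proof.
apply/measurable_EFinP; apply: measurable_funM; apply: measurable_maxr => //.
  by apply: measurableT_comp => //; exact: measurable_snd.
apply: measurable_funB => //; apply: measurable_funD => //.
apply: measurable_funD; apply: measurableT_comp => //.
Qed.

Lemma measurable_gainr H z : measurable_fun setT (gain H z).
Proof. exact: measurableT_comp (measurable_gain H) (measurable_pair1 z). Qed.

Lemma measurable_gainl H s : measurable_fun setT (gain H ^~ s).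
Proof. exact: measurableT_comp (measurable_gain H) (measurable_pair2 s). Qed.

(** The factor z.2^+ leaves the integral, and Jensen applies with c = H - (z.1 + z.2). *)
Lemma gain_mean_service (F : probability R R) (m H : R) z :
  F [set s | (s < 0)%R] = 0 -> 'E_F[fun s : R => s] = m%:E ->
  gain H z m <= \int[F]_s gain H z s.
Proof.
move=> F0 Fm; rewrite /gain.
under eq_integral do rewrite EFinM.
rewrite ge0_integralZl//.
- rewrite EFinM lee_wpmul2l ?lee_fin ?le_max ?lexx ?orbT// opprD addrA.
  apply: le_trans (mean_positive_part F0 Fm _) _.
  by under eq_integral do rewrite opprD addrA.
- apply/measurable_EFinP; apply: measurable_maxr => //.
  by apply: measurable_funB => //; exact: measurable_funD.
- by move=> s _; rewrite lee_fin le_max lexx orbT.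
- by rewrite lee_fin le_max lexx orbT.
Qed.

End gain.

(** * Mean gains within one queue *)

Section one_queue.
Local Open Scope ereal_scope.
Context d (T : measurableType d) (R : realType) (P : probability T R).
Variables (FX FS : probability R R) (X S : nat -> {RV P >-> R}).
Hypothesis queue : GGinf_queue FX FS X S.

(** The first component is the generation time of the preceding packet, not of packet n: this makes
    the two components independent. *)
Definition gen_pair (n : nat) (w : T) : R * R := (last_gen X n w, X n w).

Lemma measurable_gen_pair n : measurable_fun setT (gen_pair n).
Proof. by apply: measurable_fun_pair => //; exact: measurable_last_gen. Qed.

Lemma mean_gain_service n H :
  \int[P]_w gain H (gen_pair n w) (S n w) =
  \int[P]_w \int[FS]_s gain H (gen_pair n w) s.
Proof.
apply: (integral_indep_pair (f := fun y => gain H y.1 y.2)) => //.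
- exact: measurable_gen_pair.
- by move=> E B mE mB; exact: (service_law queue).
- exact: measurable_gain.
- by move=> z; exact: gain_ge0.
Qed.

Lemma mean_gain_ge n H (m : R) :
  FS [set s | (s < 0)%R] = 0 -> 'E_FS[fun s : R => s] = m%:E ->
  \int[P]_w gain H (gen_pair n w) m <= \int[P]_w gain H (gen_pair n w) (S n w).
Proof.
move=> FS0 FSm; rewrite mean_gain_service.
apply: (le_integral_off_null measurable0 (measure0 _)) => w _.
  exact: gain_ge0.
exact: gain_mean_service.
Qed.

(** A countable union of null events is null; this gathers the almost sure constraints on all
    packets into one exceptional set. *)
Lemma queue_null_set (A B : set R) : measurable A -> measurable B ->
  FX A = 0 -> FS B = 0 ->
  exists N : set T, [/\ measurable N, P N = 0 &
    forall w, ~ N w -> forall i, ~ A (X i w) /\ ~ B (S i w)].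
Proof.
move=> mA mB FXA FSB; have [lawX lawS _] := queue.
have : P.-negligible (\bigcup_i (X i @^-1` A `|` S i @^-1` B)).
  apply: negligible_bigcup => i; apply: negligibleU.
    exists (X i @^-1` A); split => //; last by rewrite -FXA -(lawX i).
    by rewrite -[X in measurable X]setTI; exact: measurable_funP.
  exists (S i @^-1` B); split => //; last by rewrite -FSB -(lawS i).
  by rewrite -[X in measurable X]setTI; exact: measurable_funP.
move=> [N [mN N0 sN]]; exists N; split => // w Nw i.
by split => wi; apply: Nw; apply: sN; exists i => //; [left | right].
Qed.

End one_queue.

(** * Equality of generation laws across two probability spaces *)

Section two_queues.
Local Open Scope ereal_scope.
Context (R : realType) (FX : probability R R).
Context d (T : measurableType d) (P : probability T R) (FS : probability R R)
  (X S : nat -> {RV P >-> R}).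
Context d' (T' : measurableType d') (P' : probability T' R)
  (FS' : probability R R) (X' S' : nat -> {RV P' >-> R}).
Hypotheses (queue : GGinf_queue FX FS X S) (queue' : GGinf_queue FX FS' X' S').

(** In each queue the pair has the law of [last_gen n] times [FX], so equal laws of [last_gen n]
    suffice. *)
Let eq_pair n :
  (forall A, measurable A -> P (last_gen X n @^-1` A) = P' (last_gen X' n @^-1` A)) ->
  forall E, measurable E -> P (gen_pair X n @^-1` E) = P' (gen_pair X' n @^-1` E).
Proof.
move=> IH E mE.
pose Z' : {mfun T' >-> (R * R)%type} := mfun_Sub (mem_set (measurable_gen_pair X' n)).
apply: (@pair_law_unique _ _ _ _ _ _ _ P (last_gen X n) (X n) _ _ (distribution P' Z')) => //.
  exact: measurable_last_gen.
move=> A B mA mB; rewrite (last_gen_law queue)// IH//.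
by rewrite -(last_gen_law queue').
Qed.

Lemma last_gen_same_law n A : measurable A ->
  P (last_gen X n @^-1` A) = P' (last_gen X' n @^-1` A).
Proof.
elim: n A => [|n IHn] A mA.
  have l0 d0 (T0 : measurableType d0) (P0 : probability T0 R)
      (Y : nat -> {RV P0 >-> R}) : last_gen Y 0 = cst 0%R.
    by apply/funext => w; rewrite /last_gen big_ord0.
  rewrite !l0 !preimage_cst; case: ifP => _.
    by rewrite !probability_setT.
  by rewrite !measure0.
have lS d0 (T0 : measurableType d0) (P0 : probability T0 R)
    (Y : nat -> {RV P0 >-> R}) : last_gen Y n.+1 @^-1` A =
    gen_pair Y n @^-1` ((fun z : R * R => z.1 + z.2)%R @^-1` A).
  by apply/seteqP; split => w /=; rewrite /last_gen big_ord_recr.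
rewrite !lS; apply: eq_pair => //.
rewrite -[X in measurable X]setTI.
by apply: (measurable_funD measurable_fst measurable_snd).
Qed.

(** With the service frozen at m, the mean gain depends only on the law of [gen_pair], which both
    queues share. *)
Lemma mean_gain_same n H m :
  \int[P]_w gain H (gen_pair X n w) m = \int[P']_w gain H (gen_pair X' n w) m.
Proof.
have mg := measurable_gainl H m.
pose Z : {mfun T >-> (R * R)%type} := mfun_Sub (mem_set (measurable_gen_pair X n)).
pose Z' : {mfun T' >-> (R * R)%type} := mfun_Sub (mem_set (measurable_gen_pair X' n)).
rewrite -[LHS](@ge0_integral_distribution _ _ _ _ _ P Z _ mg); last first.
  by move=> z; exact: gain_ge0.
rewrite -[RHS](@ge0_integral_distribution _ _ _ _ _ P' Z' _ mg); last first.
  by move=> z; exact: gain_ge0.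
apply: eq_measure_integral => E mE _.
by apply: eq_pair => // A mA; exact: last_gen_same_law.
Qed.

End two_queues.

(** * The mean age over a finite horizon *)

Section mean_age.
Local Open Scope ereal_scope.
Context d (T : measurableType d) (R : realType) (P : probability T R).
Variables X S : nat -> {RV P >-> R}.
Variable N : set T.
Hypotheses (mN : measurable N) (PN0 : P N = 0).
Hypothesis X_gt0 : forall w, ~ N w -> forall i, (0 < X i w)%R.
Hypothesis S_ge0 : forall w, ~ N w -> forall i, (0 <= S i w)%R.
Variable H : R.
Hypothesis H_gt0 : (0 < H)%R.

(** This is H^2/2, left unevaluated because only its finiteness matters. *)
Let K := \int[lebesgue_measure]_(t in `[0%R, H]) (t : R)%:E.
Let total w := \sum_(i <oo) gain H (gen_pair X i w) (S i w).
Let mean_on w := (H^-1 * \int[lebesgue_measure]_(t in `[0%R, H]) age X S t w)%R.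

Let K_fin : K \is a fin_num.
Proof.
apply: (@integrable_fin_num _ _ _ lebesgue_measure) => //.
exact: integrable_id_itv.
Qed.

Let integral_K : \int[P]_w K = K.
Proof.
rewrite -(fineK K_fin) integral_cst//.
by rewrite -[RHS]mule1 -(@probability_setT _ _ _ P).
Qed.

Let total_ge0 w : 0 <= total w.
Proof. by apply: nneseries_ge0 => i _ _; exact: gain_ge0. Qed.

Let totalE w : ~ N w -> total w =
  \sum_(i <oo) (X i w * Num.max (H - (path_gen (X^~ w) i + S i w)) 0)%:E.
Proof.
move=> Nw; apply: eq_eseriesr => i _; rewrite /gain /=.
rewrite (max_l (ltW (X_gt0 Nw i))) /path_gen big_ord_recr/=.
by rewrite /last_gen.
Qed.

(** The integral of the age is nonnegative and at most [K - total w]. *)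
Let total_le w : ~ N w -> total w <= K.
Proof.
move=> Nw; rewrite totalE//.
rewrite -sube_ge0 ?K_fin ?orbT//.
apply: le_trans (integral_path_age_ge0 (X^~ w) (S_ge0 Nw) H) _.
exact: integral_path_age_le (X_gt0 Nw) (S_ge0 Nw) H.
Qed.

Let mean_on_path w : mean_on w = (H^-1 * fine
  (\int[lebesgue_measure]_(t in `[0%R, H]) (path_age (X^~ w) (S^~ w) t)%:E)%E)%R.
Proof. by []. Qed.

Let mean_on_ge0 w : ~ N w -> (0 <= mean_on w)%R.
Proof.
move=> Nw; rewrite mean_on_path mulr_ge0 ?invr_ge0 ?(ltW H_gt0)// fine_ge0//.
exact: (@integral_path_age_ge0 _ (X^~ w) (S^~ w) (S_ge0 Nw) H).
Qed.

(** The real-valued integral in [mean_on] goes through [fine], so finiteness is needed here; it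
    comes from the bound by K. *)
Let mean_onE w : ~ N w -> (mean_on w)%:E =
  H^-1%:E *
  \int[lebesgue_measure]_(t in `[0%R, H]) (path_age (X^~ w) (S^~ w) t)%:E.
Proof.
move=> Nw; rewrite mean_on_path EFinM fineK// ge0_fin_numE; last first.
  exact: (@integral_path_age_ge0 _ (X^~ w) (S^~ w) (S_ge0 Nw) H).
apply: le_lt_trans (integral_path_age_le (X_gt0 Nw) (S_ge0 Nw) H) _.
rewrite -totalE//; apply: (@le_lt_trans _ _ K).
  by rewrite -[leRHS]sube0 leeB.
by rewrite ltey_eq K_fin.
Qed.

Let measurable_total : measurable_fun setT total.
Proof.
apply: ge0_emeasurable_sum => [i w _ _|i _]; first exact: gain_ge0.
pose f w := (gen_pair X i w, S i w).
apply: (measurableT_comp (measurable_gain H) (_ : measurable_fun setT f)).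
by apply: measurable_fun_pair => //; exact: measurable_gen_pair.
Qed.

Let integral_total : \int[P]_w total w =
  \sum_(i <oo) \int[P]_w gain H (gen_pair X i w) (S i w).
Proof.
rewrite integral_nneseries// => [i|i w _]; last exact: gain_ge0.
pose f w := (gen_pair X i w, S i w).
apply: (measurableT_comp (measurable_gain H) (_ : measurable_fun setT f)).
by apply: measurable_fun_pair => //; exact: measurable_gen_pair.
Qed.

Let integrable_total : P.-integrable setT total.
Proof.
apply/integrableP; split => //.
apply: (@le_lt_trans _ _ (\int[P]_w K)).
  apply: (le_integral_off_null mN PN0) => // w Nw.
  by rewrite gee0_abs// total_le.
by rewrite integral_K ltey_eq K_fin.
Qed.

Let integral_residual : \int[P]_w (H^-1%:E * (K - total w)) =
  H^-1%:E * (K - \sum_(i <oo) \int[P]_w gain H (gen_pair X i w) (S i w)).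
Proof.
have intK : P.-integrable setT (fun=> K).
  by rewrite -(fineK K_fin); exact: finite_measure_integrable_cst.
rewrite integralZl//; last exact: integrableB.
by rewrite integralB// integral_total integral_K.
Qed.

Lemma mean_age_le : 'E_P[mean_on] <=
  H^-1%:E * (K - \sum_(i <oo) \int[P]_w gain H (gen_pair X i w) (S i w)).
Proof.
rewrite -integral_residual unlock.
apply: (le_integral_off_null mN PN0) => w Nw.
  by rewrite lee_fin mean_on_ge0.
rewrite mean_onE// lee_wpmul2l ?lee_fin ?invr_ge0 ?(ltW H_gt0)// totalE//.
exact: integral_path_age_le (X_gt0 Nw) (S_ge0 Nw) H.
Qed.

(** The pathwise equality for constant service reverses the bound of [mean_age_le]. *)
Lemma mean_age_cst (c : R) : (forall w, ~ N w -> forall i, S i w = c) ->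
  H^-1%:E * (K - \sum_(i <oo) \int[P]_w gain H (gen_pair X i w) (S i w)) <=
  'E_P[mean_on].
Proof.
move=> Sc; rewrite -integral_residual unlock.
apply: (le_integral_off_null mN PN0) => w Nw.
  by rewrite mule_ge0 ?lee_fin ?invr_ge0 ?(ltW H_gt0)// sube_ge0 ?K_fin ?orbT// total_le.
rewrite mean_onE// totalE// /K.
by rewrite -(integral_path_age_cst (X_gt0 Nw) (S_ge0 Nw) H (Sc _ Nw)).
Qed.

End mean_age.

(** * Passage to the limit superior and conclusion *)

(** Any neighbourhood of infinity can be cut down to positive reals, so comparison there is
    enough. *)
Lemma le_limf_esup_pinfty (R : realType) (f g : R -> \bar R) :
  (forall x, 0 < x -> (f x <= g x)%E) ->
  (limf_esup f +oo%R <= limf_esup g +oo%R)%E.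
Proof.
move=> fg; rewrite !limf_esupE; apply: le_ereal_inf_tmp => _ [V FV <-].
apply: (@le_trans _ _ (ereal_sup (f @` (V `&` [set x | 0 < x])))).
  apply: ereal_inf_lbound; exists (V `&` [set x | 0 < x]) => //.
  by apply: filterI => //; exact: nbhs_pinfty_gt.
apply: ge_ereal_sup => _ [x [Vx x0] <-].
by apply: le_trans (fg x x0) _; apply: ereal_sup_ubound; exists x.
Qed.

Theorem theorem8 (R : realType) (lambda mu : R) (FX FS : probability R R)
  (lambda_gt0 : 0 < lambda) (lambda_lt_mu : lambda < mu)
  (FX_pos : FX [set x : R | x <= 0] = 0%E)
  (FX_mean : ('E_FX[fun x : R => x] = (lambda^-1)%:E)%E)
  (FS_ge0 : FS [set s : R | s < 0] = 0%E)
  (FS_mean : ('E_FS[fun s : R => s] = (mu^-1)%:E)%E)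
  (d : measure_display) (T : measurableType d) (P : probability T R)
  (X S : nat -> {RV P >-> R})
  (d' : measure_display) (T' : measurableType d') (P' : probability T' R)
  (X' S' : nat -> {RV P' >-> R}) :
  GGinf_queue FX FS X S -> GDinf_queue FX mu^-1 X' S' ->
  (average_age X S <= average_age X' S')%E.
Proof.
move=> queue queue'.
have mneg : measurable [set s : R | s < 0].
  by rewrite -set_itvNyo; exact: measurable_itv.
have mnpos : measurable [set x : R | x <= 0].
  by rewrite -set_itvNyc; exact: measurable_itv.
have mne : measurable (~` [set mu^-1] : set R) by exact: measurableC.
have mu_gt0 : 0 < mu by exact: lt_trans lambda_lt_mu.
have [N [mN N0 NP]] := queue_null_set queue mnpos mneg FX_pos FS_ge0.
have dirac0 : (\d_(mu^-1) : probability R R) (~` [set mu^-1]) = 0%E.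
  by rewrite /= diracE memNset// => /(_ erefl).
(* The Dirac law charges nothing off 1/mu, so almost surely all services in the second queue equal
   1/mu. *)
have [N' [mN' N'0 NP']] := queue_null_set queue' mnpos mne FX_pos dirac0.
have S'E w : ~ N' w -> forall i, S' i w = mu^-1.
  by move=> /NP' + i => /(_ i)[_ /contrapT].
apply: le_limf_esup_pinfty => H H0.
apply: (@le_trans _ _ _ _ _ (mean_age_le mN N0 _ _ H0)).
- by move=> w /NP + i => /(_ i)[/negP]; rewrite -ltNge.
- by move=> w /NP + i => /(_ i)[_ /negP]; rewrite -leNgt.
apply: le_trans (mean_age_cst mN' N'0 _ _ H0 S'E); last first.
- by move=> w /S'E Sw i; rewrite Sw invr_ge0 ltW.
- by move=> w /NP' + i => /(_ i)[/negP]; rewrite -ltNge.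
rewrite lee_wpmul2l ?lee_fin ?invr_ge0 ?(ltW H0)//.
rewrite leeB//; apply: lee_nneseries => i.
  by move=> _ _; apply: integral_ge0 => w _; exact: gain_ge0.
(* Jensen in the first queue replaces [S i] by 1/mu; the resulting mean gain is then carried over to
   the second queue, where integrating against the Dirac law gives the same value. *)
move=> _; apply: le_trans (mean_gain_ge queue i H FS_ge0 FS_mean).
rewrite (mean_gain_same queue queue') (mean_gain_service queue').
apply: (le_integral_off_null measurable0 (measure0 _)) => w _.
  by apply: integral_ge0 => s _; exact: gain_ge0.
rewrite integral_dirac//; last exact: measurable_gainr.
by rewrite diracT mul1e.
Qed.
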